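(* For each orbit compact orbigroupoid $\mathcal{G}$ there is an integer $n\geq 1$ such that there is an isomorphism of groupoids $$\Lambda(\mathcal{G})\simeq\mathrm{GMap}( *_{\mathbb{Z}/n},\mathcal{G}).$$
   Context: A topological groupoid $\mathcal{G}$ is a groupoid internal to topological spaces, with space of objects $\mathcal{G}_0$, space of arrows $\mathcal{G}_1$, and continuous source $s$, target $t$, unit, composition and inverse maps. Composites are written $g_2g_1=g_2\circ g_1$ when $t(g_1)=s(g_2)$. An orbigroupoid is a topological groupoid $\mathcal{G}$ such that $\mathcal{G}_0$ and $\mathcal{G}_1$ are compactly generated, locally compact, paracompact Hausdorff spaces, $s$ and $t$ are étale (local homeomorphisms), and $(s,t):\mathcal{G}_1\to\mathcal{G}_0\times\mathcal{G}_0$ is proper (preimages of compact sets are compact). The isotropy group of $x\in\mathcal{G}_0$ is $G_x=\{g\in\mathcal{G}_1\mid s(g)=t(g)=x\}$. The quotient space $\mathcal{G}_0/\mathcal{G}_1$ is the quotient of $\mathcal{G}_0$ by the relation $x\sim y$ iff there is an arrow $x\to y$ in $\mathcal{G}_1$. An orbigroupoid $\mathcal{G}$ is orbit compact if $\mathcal{G}_0/\mathcal{G}_1$ is compact. For a finite group $G$, $*_G$ is the orbigroupoid with a single object $*$ and discrete arrow space $G$, with composition and inverses given by the group structure. $\mathrm{GMap}(\mathcal{G},\mathcal{H})$ is the groupoid whose objects are the continuous functors $f=(f_0,f_1):\mathcal{G}\to\mathcal{H}$ and whose arrows $f\to f'$ are the continuous natural transformations $\alpha:\mathcal{G}_0\to\mathcal{H}_1$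 from $f$ to $f'$, with pointwise composition. The inertia groupoid $\Lambda(\mathcal{G})$ (also written $\wedge\mathcal{G}$) has objects the pairs $(x,g)\in\mathcal{G}_0\times\mathcal{G}_1$ with $x=s(g)=t(g)$. Each arrow $h:x\to y$ in $\mathcal{G}_1$ defines, for every $g\in G_x$, an arrow $(x,g)\to(y,hgh^{-1})$. Composition is induced by that of $\mathcal{G}$. *)

(* Defs.v *)
From HB Require Import structures.
From mathcomp Require Import all_boot all_order all_fingroup all_algebra.
From mathcomp Require Import all_classical.
From mathcomp Require Import topology.

Set Implicit Arguments.
Unset Strict Implicit.
Unset Printing Implicit Defensive.

Local Open Scope classical_set_scope.
Local Open Scope quotient_scope.

(* Composites are written [comp g2 g1], "g2 after g1", and exist only for      *)
(* composable pairs: the last argument of [comp] is a proof of composability.  *)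
Record groupoidOn (O A : Type) := GroupoidOn {
  src : A -> O;
  tgt : A -> O;
  idar : O -> A;
  comp : forall g2 g1 : A, tgt g1 = src g2 -> A;
  inv : A -> A;
  src_id : forall x, src (idar x) = x;
  tgt_id : forall x, tgt (idar x) = x;
  src_comp : forall g2 g1 (e : tgt g1 = src g2), src (comp e) = src g1;
  tgt_comp : forall g2 g1 (e : tgt g1 = src g2), tgt (comp e) = tgt g2;
  src_inv : forall g, src (inv g) = tgt g;
  tgt_inv : forall g, tgt (inv g) = src g;
  compA : forall g3 g2 g1 (e12 : tgt g1 = src g2) (e23 : tgt g2 = src g3)
      (e : tgt (comp e12) = src g3) (e' : tgt g1 = src (comp e23)),
    comp e = comp e';
  comp1g : forall g (e : tgt g = src (idar (tgt g))), comp e = g;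
  compg1 : forall g (e : tgt (idar (src g)) = src g), comp e = g;
  compVg : forall g (e : tgt g = src (inv g)), comp e = idar (src g);
  compgV : forall g (e : tgt (inv g) = src g), comp e = idar (tgt g)
}.

Arguments comp {O A} _ g2 g1 _.

Section GroupoidTheory.
Variables (O A : Type) (G : groupoidOn O A).

Lemma comp_eq g2 g1 g2' g1' (e : tgt G g1 = src G g2)
    (e' : tgt G g1' = src G g2') :
  g2 = g2' -> g1 = g1' -> comp G g2 g1 e = comp G g2' g1' e'.
Proof. by move=> E2 E1; subst; congr (comp _ _ _ _); exact: Prop_irrelevance. Qed.

Lemma comp_idl x g (e : tgt G g = src G (idar G x)) : comp G (idar G x) g e = g.
Proof.
have E : x = tgt G g by rewrite e src_id.
by subst; exact: comp1g.
Qed.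

Lemma comp_idr x g (e : tgt G (idar G x) = src G g) : comp G g (idar G x) e = g.
Proof.
have E : x = src G g by rewrite -e tgt_id.
by subst; exact: compg1.
Qed.

Lemma compKV g2 g1 (e : tgt G g1 = src G g2)
    (e' : tgt G (inv G g1) = src G (comp G g2 g1 e)) :
  comp G (comp G g2 g1 e) (inv G g1) e' = g2.
Proof.
have e1 : tgt G (inv G g1) = src G g1 by rewrite tgt_inv.
have e2 : tgt G (comp G g1 (inv G g1) e1) = src G g2 by rewrite tgt_comp.
rewrite -(compA e2 _).
have e3 : tgt G (idar G (tgt G g1)) = src G g2 by rewrite tgt_id.
rewrite -[RHS](comp_idr e3); apply: comp_eq => //; exact: compgV.
Qed.

Lemma compKl g2 g1 (e : tgt G g1 = src G g2)
    (e' : tgt G (comp G g2 g1 e) = src G (inv G g2)) :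
  comp G (inv G g2) (comp G g2 g1 e) e' = g1.
Proof.
have e1 : tgt G g2 = src G (inv G g2) by rewrite src_inv.
have e2 : tgt G g1 = src G (comp G (inv G g2) g2 e1) by rewrite src_comp.
rewrite (compA _ e2).
have e3 : tgt G g1 = src G (idar G (src G g2)) by rewrite src_id.
rewrite -[RHS](comp_idl e3); apply: comp_eq => //; exact: compVg.
Qed.

Lemma square_inv k p q h (e : tgt G p = src G k) (e' : tgt G h = src G q)
    (e1 : tgt G (inv G p) = src G h) (e2 : tgt G k = src G (inv G q)) :
  comp G k p e = comp G q h e' -> comp G h (inv G p) e1 = comp G (inv G q) k e2.
Proof.
move=> E.
have e3 : tgt G (comp G q h e') = src G (inv G q) by rewrite tgt_comp src_inv.
have e4 : tgt G (comp G k p e) = src G (inv G q) by rewrite tgt_comp.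
have e5 : tgt G p = src G (comp G (inv G q) k e2) by rewrite src_comp.
have hE : h = comp G (comp G (inv G q) k e2) p e5.
  by rewrite -(compA e4 _) -[LHS](compKl e3); exact: comp_eq.
have e6 : tgt G (inv G p) = src G (comp G (comp G (inv G q) k e2) p e5).
  by rewrite -hE.
by rewrite -[RHS](compKV e6); exact: comp_eq.
Qed.

End GroupoidTheory.

Record groupoid := Groupoid {
  ob : Type;
  ar : Type;
  gstr :> groupoidOn ob ar
}.

Record functor (O A O' A' : Type) (G : groupoidOn O A) (H : groupoidOn O' A') :=
  Functor {
  fob : O -> O';
  far : A -> A';
  src_far : forall g, src H (far g) = fob (src G g);
  tgt_far : forall g, tgt H (far g) = fob (tgt G g);
  far_id : forall x, far (idar G x) = idar H (fob x);
  far_comp : forall g2 g1 (e : tgt G g1 = src G g2)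
      (e' : tgt H (far g1) = src H (far g2)),
    far (comp G g2 g1 e) = comp H (far g2) (far g1) e'
}.

Definition groupoid_iso (G H : groupoid) : Prop :=
  exists (F : functor G H) (K : functor H G),
    [/\ cancel (fob F) (fob K), cancel (fob K) (fob F),
        cancel (far F) (far K) & cancel (far K) (far F)].

Definition composable (O A : Type) (s t : A -> O) : set (A * A) :=
  [set p | t p.2 = s p.1].

Definition comp_pair (O A : Type) (G : groupoidOn O A)
    (p : composable (src G) (tgt G)) : A :=
  comp G (set_val p).1 (set_val p).2 (set_mem (valP p)).

(* The domain of composition carries the subspace topology of the product.     *)
Record topGroupoid := TopGroupoid {
  tob : topologicalType;
  tar : topologicalType;
  tstr :> groupoidOn tob tar;
  src_continuous : continuous (src tstr);
  tgt_continuous : continuous (tgt tstr);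
  id_continuous : continuous (idar tstr);
  comp_continuous : continuous (comp_pair (G := tstr));
  inv_continuous : continuous (inv tstr)
}.

(* In the topology of [subspace K] the points outside K are isolated, so that  *)
(* [closed (A : set (subspace K))] says that the trace of A on K is closed     *)
(* in K.                                                                       *)
Definition compactly_generated (X : topologicalType) : Prop :=
  forall A : set X,
    (forall K : set X, compact K -> closed (A : set (subspace K))) -> closed A.

Definition paracompact (X : topologicalType) : Prop :=
  forall C : set (set X), C `<=` open -> \bigcup_(U in C) U = setT ->
  exists D : set (set X),
    [/\ D `<=` open, \bigcup_(V in D) V = setT,
        forall V, D V -> exists2 U, C U & V `<=` U &
        forall x : X, exists2 N, nbhs x N &
          finite_set [set V | D V /\ V `&` N !=set0]].

(* g is a local inverse of f, extended arbitrarily outside the open set f(U).  *)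
Definition etale (X Y : topologicalType) (f : X -> Y) : Prop :=
  forall x, exists (U : set X) (g : Y -> X),
    [/\ open U, U x & open (f @` U)] /\
    [/\ {within U, continuous f}, {within f @` U, continuous g} &
        forall u, U u -> g (f u) = u].

Definition proper_map (X Y : topologicalType) (f : X -> Y) : Prop :=
  forall K : set Y, compact K -> compact (f @^-1` K).

Definition orbi_space (X : topologicalType) : Prop :=
  [/\ compactly_generated X, locally_compact [set: X], paracompact X &
      hausdorff_space X].

Definition orbigroupoid (G : topGroupoid) : Prop :=
  [/\ orbi_space (tob G), orbi_space (tar G), etale (src G), etale (tgt G) &
      proper_map (fun g : tar G => (src G g, tgt G g))].

Section Orbits.
Variable G : topGroupoid.

Definition orbit_rel : rel (tob G) :=
  fun x y => `[< exists g, src G g = x /\ tgt G g = y >].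

Lemma orbit_rel_refl : reflexive orbit_rel.
Proof.
by move=> x; apply/asboolP; exists (idar G x); rewrite src_id tgt_id.
Qed.

Lemma orbit_rel_sym : symmetric orbit_rel.
Proof.
move=> x y; apply/asboolP/asboolP => -[g [<- <-]]; exists (inv G g);
  by rewrite src_inv tgt_inv.
Qed.

Lemma orbit_rel_trans : transitive orbit_rel.
Proof.
move=> y x z /asboolP[g [sg tg]] /asboolP[h [sh th]]; apply/asboolP.
have e : tgt G g = src G h by rewrite tg sh.
by exists (comp G h g e); rewrite src_comp tgt_comp.
Qed.

Canonical orbit_equiv :=
  EquivRel orbit_rel orbit_rel_refl orbit_rel_sym orbit_rel_trans.

Definition orbit_space : topologicalType :=
  quotient_topology {eq_quot orbit_equiv}.

Definition orbit_compact : Prop := compact [set: orbit_space].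

End Orbits.

Section OneObject.
Variable gT : finGroupType.
Local Open Scope group_scope.

Definition one_object_str :
  groupoidOn (discrete_topology unit) (discrete_topology gT).
Proof.
refine (@GroupoidOn (discrete_topology unit) (discrete_topology gT)
  (fun=> tt) (fun=> tt) (fun=> (1 : gT))
  (fun g2 g1 _ => (g2 : gT) * (g1 : gT)) (fun g => (g : gT)^-1)
  _ _ _ _ _ _ _ _ _ _ _) => //.
- by case.
- by case.
- by move=> *; exact: mulgA.
- by move=> *; exact: mul1g.
- by move=> *; exact: mulg1.
- by move=> *; exact: mulVg.
- by move=> *; exact: mulgV.
Defined.

Lemma discrete_continuous (X : discreteTopologicalType) (Y : topologicalType)
  (f : X -> Y) : continuous f.
Proof. by apply/continuousP => A _; exact: discrete_open. Qed.

Lemma one_object_comp_continuous :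
  continuous (comp_pair (G := one_object_str)).
Proof.
have mul_continuous : continuous (fun p : discrete_topology gT *
    discrete_topology gT => (p.1 : gT) * (p.2 : gT) : discrete_topology gT).
  move=> [a b] U /= Uab; exists ([set a], [set b]) => /=.
    by split; exact: discrete_set1.
  by move=> [c d] /= [-> ->]; exact: nbhs_singleton Uab.
move=> p; apply: (@continuous_comp _ _ _ set_val _ p _ (mul_continuous _)).
exact: initial_continuous.
Qed.

Definition one_object : topGroupoid.
Proof.
refine (@TopGroupoid (discrete_topology unit) (discrete_topology gT)
  one_object_str _ _ _ one_object_comp_continuous _);
  exact: discrete_continuous.
Defined.

Lemma discrete_orbi_space (X : discreteTopologicalType) : orbi_space X.
Proof.
split; last exact: discrete_hausdorff.
- by move=> A _; exact: discrete_closed.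
- move=> x _; rewrite withinET.
  exists [set x]; first exact: discrete_set1.
  by split; [exact: compact_set1 | exact: discrete_closed].
- move=> C oC cC; exists [set [set x] | x in [set: X]]; split.
  + by move=> V _; exact: discrete_open.
  + by apply/seteqP; split => // x _; exists [set x] => //; exists x.
  + move=> V [x _ <-]; have : [set: X] x by [].
    by rewrite -cC => -[U CU Ux]; exists U => // y ->.
  + move=> x; exists [set x]; first exact: discrete_set1.
    apply: (@sub_finite_set _ _ [set [set x]]); last exact: finite_set1.
    by move=> V [[y _ <-] [z [/= -> ->]]].
Qed.

Lemma discrete_etale (X Y : discreteTopologicalType) (f : X -> Y) : etale f.
Proof.
move=> x; exists [set x], (fun=> x); split; split.
- exact: discrete_open.
- by [].
- exact: discrete_open.
- by apply: continuous_subspaceT; exact: discrete_continuous.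
- by apply: continuous_subspaceT => y; exact: cvg_cst.
- by move=> u ->.
Qed.

Lemma one_object_orbigroupoid : orbigroupoid one_object.
Proof.
split; try exact: discrete_orbi_space; try exact: discrete_etale.
by move=> K _; apply: finite_compact; exact: (@finite_finset gT).
Qed.

End OneObject.

(* For n >= 1 this is Z/n under addition, the trivial group when n = 1         *)
(* (whereas 'Z_1 is Z/2).                                                      *)
Definition Zmod (n : nat) : finGroupType := 'I_n.-1.+1.

Record cfunctor (G H : topGroupoid) := CFunctor {
  cfun :> functor G H;
  fob_continuous : continuous (fob cfun);
  far_continuous : continuous (far cfun)
}.

Record cnat (G H : topGroupoid) (f f' : cfunctor G H) := CNat {
  nat_fun :> tob G -> tar H;
  nat_continuous : continuous nat_fun;
  src_nat : forall x, src H (nat_fun x) = fob f x;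
  tgt_nat : forall x, tgt H (nat_fun x) = fob f' x;
  natural : forall (g : tar G)
      (e : tgt H (nat_fun (src G g)) = src H (far f' g))
      (e' : tgt H (far f g) = src H (nat_fun (tgt G g))),
    comp H (far f' g) (nat_fun (src G g)) e =
    comp H (nat_fun (tgt G g)) (far f g) e'
}.

Record gmap_ar (G H : topGroupoid) := GMapAr {
  gm_src : cfunctor G H;
  gm_tgt : cfunctor G H;
  gm_nat :> cnat gm_src gm_tgt
}.

Section GMap.
Variables G H : topGroupoid.

Lemma gmap_ar_eq (a b : gmap_ar G H) :
  gm_src a = gm_src b -> gm_tgt a = gm_tgt b ->
  (forall x, a x = b x) -> a = b.
Proof.
case: a b => [f f' [a ac as_ at_ an]] [k k' [b bc bs bt bn]] /= E1 E2 E.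
have {}E : a = b by exact/funext.
subst; congr (@GMapAr _ _ _ _ _).
by rewrite (Prop_irrelevance ac bc) (Prop_irrelevance as_ bs)
  (Prop_irrelevance at_ bt) (Prop_irrelevance an bn).
Qed.

Program Definition gmap_id (f : cfunctor G H) : gmap_ar G H :=
  @GMapAr G H f f (@CNat G H f f (fun x => idar H (fob f x)) _ _ _ _).
Next Obligation.
move=> f x; apply: continuous_comp; first exact: fob_continuous.
exact: id_continuous.
Qed.
Next Obligation. by move=> f x; rewrite src_id. Qed.
Next Obligation. by move=> f x; rewrite tgt_id. Qed.
Next Obligation.
move=> f g /=; rewrite -src_far -tgt_far => e e'.
by rewrite compg1 comp1g.
Qed.

Lemma gmap_composable (b a : gmap_ar G H) (e : gm_tgt a = gm_src b) x :
  tgt H (a x) = src H (b x).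
Proof. by rewrite tgt_nat src_nat e. Qed.

Definition gmap_comp_fun (b a : gmap_ar G H) (e : gm_tgt a = gm_src b) :
    tob G -> tar H :=
  fun x => comp H (b x) (a x) (gmap_composable e x).

Program Definition gmap_comp (b a : gmap_ar G H) (e : gm_tgt a = gm_src b) :
  gmap_ar G H :=
  @GMapAr G H (gm_src a) (gm_tgt b)
    (@CNat G H _ _ (gmap_comp_fun e) _ _ _ _).
Next Obligation.
move=> b a e.
pose F x : composable (src H) (tgt H) :=
  exist _ (b x, a x) (mem_set (gmap_composable e x)).
rewrite (_ : gmap_comp_fun e = comp_pair (G := H) \o F); last first.
  by apply/funext => x; exact: comp_eq.
move=> x; apply: continuous_comp; last exact: comp_continuous.
apply: continuous_comp_initial x => x.
by apply: cvg_pair; exact: nat_continuous.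
Qed.
Next Obligation. by move=> b a e x; rewrite src_comp src_nat. Qed.
Next Obligation. by move=> b a e x; rewrite tgt_comp tgt_nat. Qed.
Next Obligation.
move=> [f' f'' b] [f k a] /= e; subst f' => g; rewrite /gmap_comp_fun /= => e1 e2.
have ebs : tgt H (b (src G g)) = src H (far f'' g).
  by rewrite tgt_nat src_far.
have eas : tgt H (a (src G g)) = src H (far k g).
  by rewrite tgt_nat src_far.
have ebt : tgt H (far k g) = src H (b (tgt G g)).
  by rewrite src_nat tgt_far.
have eat : tgt H (far f g) = src H (a (tgt G g)).
  by rewrite src_nat tgt_far.
have nb := natural ebs ebt; have na := natural eas eat.
have E1 : tgt H (a (src G g)) = src H (comp H (far f'' g) (b (src G g)) ebs).
  by rewrite src_comp tgt_nat src_nat.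
have E2 : tgt H (a (src G g)) = src H (comp H (b (tgt G g)) (far k g) ebt).
  by rewrite src_comp.
have E3 : tgt H (comp H (far k g) (a (src G g)) eas) = src H (b (tgt G g)).
  by rewrite tgt_comp.
have E4 : tgt H (comp H (a (tgt G g)) (far f g) eat) = src H (b (tgt G g)).
  by rewrite tgt_comp tgt_nat src_nat.
rewrite (compA _ E1).
transitivity (comp H (comp H (b (tgt G g)) (far k g) ebt) (a (src G g)) E2).
  exact: comp_eq.
rewrite -(compA E3 _).
transitivity (comp H (b (tgt G g)) (comp H (a (tgt G g)) (far f g) eat) E4).
  exact: comp_eq.
exact: compA.
Qed.

Program Definition gmap_inv (a : gmap_ar G H) : gmap_ar G H :=
  @GMapAr G H (gm_tgt a) (gm_src a)
    (@CNat G H _ _ (fun x => inv H (a x)) _ _ _ _).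
Next Obligation.
move=> a x; apply: continuous_comp; first exact: nat_continuous.
exact: inv_continuous.
Qed.
Next Obligation. by move=> a x; rewrite src_inv tgt_nat. Qed.
Next Obligation. by move=> a x; rewrite tgt_inv src_nat. Qed.
Next Obligation.
move=> a g /= e e'; apply: square_inv.
- by rewrite tgt_nat src_far.
- by rewrite src_nat tgt_far.
- by move=> *; exact: natural.
Qed.

Program Definition gmap_str : groupoidOn (cfunctor G H) (gmap_ar G H) :=
  @GroupoidOn _ _ (@gm_src G H) (@gm_tgt G H) gmap_id gmap_comp gmap_inv
    _ _ _ _ _ _ _ _ _ _ _.
Next Obligation. by []. Qed.
Next Obligation. by []. Qed.
Next Obligation. by []. Qed.
Next Obligation. by []. Qed.
Next Obligation. by []. Qed.
Next Obligation. by []. Qed.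
Next Obligation.
by move=> c b a *; apply: gmap_ar_eq => // x; exact: compA.
Qed.
Next Obligation.
by move=> a e; apply: gmap_ar_eq => // x; exact: comp_idl.
Qed.
Next Obligation.
by move=> a e; apply: gmap_ar_eq => // x; exact: comp_idr.
Qed.
Next Obligation.
move=> a e; apply: gmap_ar_eq => // x.
by rewrite /= -(src_nat a); exact: compVg.
Qed.
Next Obligation.
move=> a e; apply: gmap_ar_eq => // x.
by rewrite /= -(tgt_nat a); exact: compgV.
Qed.

Definition GMap : groupoid := Groupoid gmap_str.

End GMap.

Section Inertia.
Variable G : topGroupoid.

Record inertia_ob := InertiaOb {
  in_pt : tob G;
  in_loop : tar G;
  src_loop : src G in_loop = in_pt;
  tgt_loop : tgt G in_loop = in_pt
}.

Record inertia_ar := InertiaAr {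
  in_src : inertia_ob;
  in_ar : tar G;
  src_in_ar : src G in_ar = in_pt in_src
}.

Lemma inertia_ob_eq (p q : inertia_ob) : in_loop p = in_loop q -> p = q.
Proof.
case: p q => [x g sg tg] [y k sk tk] /= E; subst.
by congr InertiaOb; exact: Prop_irrelevance.
Qed.

Lemma inertia_ar_eq (a b : inertia_ar) :
  in_src a = in_src b -> in_ar a = in_ar b -> a = b.
Proof.
case: a b => [p h ph] [q k qk] /= E1 E2; subst.
by congr InertiaAr; exact: Prop_irrelevance.
Qed.

Lemma inertia_composable1 (a : inertia_ar) :
  tgt G (in_loop (in_src a)) = src G (in_ar a).
Proof. by rewrite tgt_loop src_in_ar. Qed.

Lemma inertia_composable2 (a : inertia_ar) :
  tgt G (inv G (in_ar a)) =
  src G (comp G (in_ar a) (in_loop (in_src a)) (inertia_composable1 a)).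
Proof. by rewrite tgt_inv src_comp src_loop src_in_ar. Qed.

(* (h g) h^-1, where g is the loop at the source of the arrow h *)
Definition conj_loop (a : inertia_ar) : tar G :=
  comp G (comp G (in_ar a) (in_loop (in_src a)) (inertia_composable1 a))
    (inv G (in_ar a)) (inertia_composable2 a).

Lemma src_conj_loop a : src G (conj_loop a) = tgt G (in_ar a).
Proof. by rewrite src_comp src_inv. Qed.

Lemma tgt_conj_loop a : tgt G (conj_loop a) = tgt G (in_ar a).
Proof. by rewrite !tgt_comp. Qed.

Definition in_tgt (a : inertia_ar) : inertia_ob :=
  InertiaOb (src_conj_loop a) (tgt_conj_loop a).

Lemma conj_loop_uniq a c (e : tgt G (in_ar a) = src G c) :
  comp G c (in_ar a) e =
  comp G (in_ar a) (in_loop (in_src a)) (inertia_composable1 a) ->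
  c = conj_loop a.
Proof.
move=> E; have e' : tgt G (inv G (in_ar a)) = src G (comp G c (in_ar a) e).
  by rewrite E inertia_composable2.
by rewrite -[LHS](compKV e'); exact: comp_eq.
Qed.

Lemma conj_loopE a (e : tgt G (in_ar a) = src G (conj_loop a)) :
  comp G (conj_loop a) (in_ar a) e =
  comp G (in_ar a) (in_loop (in_src a)) (inertia_composable1 a).
Proof.
set hg := RHS.
have e1 : tgt G (in_ar a) = src G (inv G (in_ar a)) by rewrite src_inv.
have e2 : tgt G (comp G (inv G (in_ar a)) (in_ar a) e1) = src G hg.
  by rewrite tgt_comp inertia_composable2.
rewrite -(compA e2 _).
have e3 : tgt G (idar G (src G (in_ar a))) = src G hg.
  by rewrite tgt_id src_comp src_loop src_in_ar.
by rewrite -[RHS](comp_idr e3); apply: comp_eq => //; exact: compVg.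
Qed.

Lemma inertia_id_src (p : inertia_ob) : src G (idar G (in_pt p)) = in_pt p.
Proof. exact: src_id. Qed.

Definition inertia_id (p : inertia_ob) : inertia_ar :=
  InertiaAr (inertia_id_src p).

Lemma inertia_comp_subproof (b a : inertia_ar) (e : in_tgt a = in_src b) :
  tgt G (in_ar a) = src G (in_ar b).
Proof. by rewrite (src_in_ar b) -e. Qed.

Lemma inertia_comp_src (b a : inertia_ar) (e : in_tgt a = in_src b) :
  src G (comp G (in_ar b) (in_ar a) (inertia_comp_subproof e)) =
  in_pt (in_src a).
Proof. by rewrite src_comp src_in_ar. Qed.

Definition inertia_comp (b a : inertia_ar) (e : in_tgt a = in_src b) :
  inertia_ar := InertiaAr (inertia_comp_src e).

Lemma inertia_inv_src (a : inertia_ar) :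
  src G (inv G (in_ar a)) = in_pt (in_tgt a).
Proof. by rewrite src_inv. Qed.

Definition inertia_inv (a : inertia_ar) : inertia_ar :=
  InertiaAr (inertia_inv_src a).

Program Definition inertia_str : groupoidOn inertia_ob inertia_ar :=
  @GroupoidOn _ _ in_src in_tgt inertia_id inertia_comp inertia_inv
    _ _ _ _ _ _ _ _ _ _ _.
Next Obligation. by []. Qed.
Next Obligation.
move=> p; apply: inertia_ob_eq => /=; apply/esym.
have e : tgt G (in_ar (inertia_id p)) = src G (in_loop p).
  by rewrite /= tgt_id src_loop.
by apply: (conj_loop_uniq (e := e)); rewrite comp_idr comp_idl.
Qed.
Next Obligation. by []. Qed.
Next Obligation.
move=> b a e; apply: inertia_ob_eq => /=; apply/esym.
have ec : tgt G (in_ar (inertia_comp e)) = src G (conj_loop b).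
  by rewrite src_conj_loop /= tgt_comp.
apply: (conj_loop_uniq (e := ec)).
have eb : tgt G (in_ar b) = src G (conj_loop b) by rewrite src_conj_loop.
have ea : tgt G (in_ar a) = src G (conj_loop a) by rewrite src_conj_loop.
have Eb := conj_loopE eb; have Ea := conj_loopE ea.
have lb : in_loop (in_src b) = conj_loop a by rewrite -e.
have e1 : tgt G (in_ar a) = src G (comp G (conj_loop b) (in_ar b) eb).
  by rewrite src_comp (inertia_comp_subproof e).
have e2 : tgt G (in_ar a) = src G (comp G (in_ar b) (in_loop (in_src b))
    (inertia_composable1 b)).
  by rewrite -Eb.
have e3 : tgt G (in_ar a) = src G (in_loop (in_src b)) by rewrite lb.
have e4 : tgt G (comp G (in_loop (in_src b)) (in_ar a) e3) = src G (in_ar b).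
  by rewrite tgt_comp inertia_composable1.
have e5 : tgt G (comp G (in_ar a) (in_loop (in_src a)) (inertia_composable1 a))
    = src G (in_ar b).
  by rewrite tgt_comp (inertia_comp_subproof e).
rewrite (compA _ e1).
transitivity (comp G _ _ e2); first exact: comp_eq.
rewrite -(compA e4 _).
transitivity (comp G _ _ e5); last exact: compA.
by apply: comp_eq => //; rewrite -Ea; exact: comp_eq.
Qed.
Next Obligation. by []. Qed.
Next Obligation.
move=> a; apply: inertia_ob_eq => /=; apply/esym.
have e : tgt G (in_ar (inertia_inv a)) = src G (in_loop (in_src a)).
  by rewrite /= tgt_inv src_in_ar src_loop.
apply: (conj_loop_uniq (e := e)) => /=; apply: square_inv => [||ea eb].
- by rewrite src_conj_loop.
- exact: inertia_composable1.
- by rewrite (conj_loopE ea); exact: comp_eq.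
Qed.
Next Obligation. by move=> *; apply: inertia_ar_eq => //; exact: compA. Qed.
Next Obligation. by move=> *; apply: inertia_ar_eq => //; exact: comp_idl. Qed.
Next Obligation.
by move=> *; apply: inertia_ar_eq => //; exact: comp_idr.
Qed.
Next Obligation.
move=> a e; apply: inertia_ar_eq => //=.
by rewrite -src_in_ar; exact: compVg.
Qed.
Next Obligation.
by move=> a e; apply: inertia_ar_eq => //=; exact: compgV.
Qed.

Definition inertia : groupoid := Groupoid inertia_str.

End Inertia.

(* Main.v *)
(* Let K be a compact neighbourhood of an object. The loops at the points of K *)
(* form the preimage of the diagonal of K under the proper map (s,t), hence a  *)
(* compact set, which is covered by finitely many, say N, open sets on which   *)
(* the etale map s is injective. So each point of K has at most N loops, and   *)
(* their orders divide N!. As s is open, such neighbourhoods have open images  *)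
(* in the orbit space, and compactness of the latter gives an n with l^n = 1   *)
(* for all loops l. For such n a functor from the one-object groupoid of Z/n   *)
(* is the same thing as a loop, the image of the generator, and a natural      *)
(* transformation is a single arrow, conjugating one loop to the other.        *)
From HB Require Import structures.
From mathcomp Require Import all_boot all_fingroup all_algebra all_classical.
From mathcomp Require Import topology.
Require Import Defs.

Set Implicit Arguments.
Unset Strict Implicit.
Unset Printing Implicit Defensive.

Local Open Scope classical_set_scope.
Local Open Scope group_scope.

(** The isomorphism exists for every n >= 1 that kills all loops ([inertia_gmap_iso]), so the
    topology serves only to produce such an n. Fibres of an etale map meet a compact set in
    boundedly many points ([etale_fibre_bound]); this gives an exponent near each object
    ([loop_exponent_near]). Exponents are invariant along orbits ([loop_expg_conj]), so orbit
    compactness makes one exponent work everywhere ([loop_exponent]). *)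

(** * Etale maps *)

Lemma etale_open_map (X Y : topologicalType) (f : X -> Y) :
  etale f -> forall W : set X, open W -> open (f @` W).
Proof.
move=> ef W oW; rewrite openE => _ [x Wx <-].
have [U [g [[oU Ux ofU] [_ cg gf]]]] := ef x.
have fUx : (f @` U) (f x) by exists x.
have {}cg : {for f x, continuous g}.
  by move: cg; rewrite continuous_open_subspace// => /(_ _ (mem_set fUx)).
have : \forall y \near f x, W (g y).
  by apply: cg; rewrite gf//; exact: open_nbhs_nbhs.
apply: filterS2 (open_nbhs_nbhs (conj ofU fUx)) => _ [u Uu <-].
by rewrite gf// => Wu; exists u.
Qed.

(** Pigeonhole: L is covered by N open sets on which f is injective, so among N + 1 points of one
    fibre two coincide. The sequence h will be the powers of a loop. *)
Lemma etale_fibre_bound (X Y : topologicalType) (f : X -> Y) (L : set X) :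
  etale f -> compact L ->
  exists N : nat, forall (y : Y) (h : nat -> X),
    (forall k, L (h k)) -> (forall k, f (h k) = y) ->
    exists i j : nat, (i < j <= N)%N /\ h i = h j.
Proof.
move=> ef /compact_near_coveringP cL.
have /choice [U HU] : forall x : X, exists U : set X, [/\ open U, U x &
    forall u v, U u -> U v -> f u = f v -> u = v].
  move=> x; have [U [g [[oU Ux _] [_ _ gf]]]] := ef x.
  by exists U; split=> // u v Uu Uv e; rewrite -(gf u Uu) -[RHS](gf v Uv) e.
(* [compact_cover] requires a pointed space; near coverings along the filter   *)
(* of finite sequences ordered by inclusion give finite subcovers without it.  *)
pose F : set_system (seq X) :=
  [set Q | exists s0 : seq X, forall s, {subset s0 <= s} -> Q s].
have FF : Filter F.
  split; first by exists [::].
  - move=> P Q [s Ps] [t Qt]; exists (s ++ t) => r sub.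
    split; [apply: Ps | apply: Qt] => z zs;
      by apply: sub; rewrite mem_cat zs ?orbT.
  - by move=> P Q PQ [s Ps]; exists s => r sub; apply: PQ; exact: Ps.
have [|s sL] := cL _ F (fun s x => exists2 u, u \in s & U u x) FF.
  move=> x _; have [oU Ux _] := HU x.
  exists (U x, [set s | x \in s]) => /=.
    split; first exact: open_nbhs_nbhs.
    by exists [:: x] => s; apply; exact: mem_head.
  by move=> [y s] [/= Uy xs]; exists x.
have {}sL : forall x, L x -> exists2 u, u \in s & U u x by exact: sL.
exists #|{: seq_sub s}| => y h Lh fh.
have /choice [c Hc] : forall k, exists d : seq_sub s, U (val d) (h k).
  by move=> k; have [d ds Ud] := sL _ (Lh k); exists (SeqSub ds).
have /injectivePn [i [j neq cij]] :
    ~~ injectiveb (fun k : 'I_#|{: seq_sub s}|.+1 => c k).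
  by apply/injectiveP => /leq_card; rewrite card_ord ltnn.
have hij : h i = h j.
  have [_ _ inj] := HU (val (c i)).
  by apply: inj; rewrite ?fh// cij; exact: Hc.
have := neq; rewrite -val_eqE neq_ltn => /orP[] lt.
- by exists i, j; rewrite lt -ltnS ltn_ord.
- by exists j, i; rewrite lt -ltnS ltn_ord.
Qed.

(** * Isotropy groups and conjugation *)

Section Loops.
Variables (O A : Type) (G : groupoidOn O A).

(** The isotropy group at x, made a [groupType] below to have powers; it need not be finite for a
    general groupoid. *)
Record loop (x : O) := Loop {
  loop_ar : A;
  src_loop_ar : src G loop_ar = x;
  tgt_loop_ar : tgt G loop_ar = x
}.

Lemma loop_eq x (k l : loop x) : loop_ar k = loop_ar l -> k = l.
Proof.
case: k l => [k sk tk] [l sl tl] /= E; subst l.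
by congr Loop; exact: Prop_irrelevance.
Qed.

Lemma loop_composable x (k l : loop x) :
  tgt G (loop_ar l) = src G (loop_ar k).
Proof. by rewrite tgt_loop_ar src_loop_ar. Qed.

Definition loop_mul x (k l : loop x) : loop x :=
  @Loop x (comp G (loop_ar k) (loop_ar l) (loop_composable k l))
    (etrans (src_comp _) (src_loop_ar l)) (etrans (tgt_comp _) (tgt_loop_ar k)).

Definition loop_one x : loop x := @Loop x (idar G x) (src_id G x) (tgt_id G x).

Definition loop_inv x (k : loop x) : loop x :=
  @Loop x (inv G (loop_ar k))
    (etrans (src_inv G _) (tgt_loop_ar k)) (etrans (tgt_inv G _) (src_loop_ar k)).

Section LoopGroup.
Variable x : O.

HB.instance Definition _ := gen_eqMixin (loop x).
HB.instance Definition _ := gen_choiceMixin (loop x).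

Fact loop_mulA : associative (@loop_mul x).
Proof. by move=> a b c; apply: loop_eq; exact: compA. Qed.

Fact loop_mul1 : left_id (loop_one x) (@loop_mul x).
Proof. by move=> a; apply: loop_eq; exact: comp_idl. Qed.

Fact loop_mulr1 : right_id (loop_one x) (@loop_mul x).
Proof. by move=> a; apply: loop_eq; exact: comp_idr. Qed.

Fact loop_mulV : left_inverse (loop_one x) (@loop_inv x) (@loop_mul x).
Proof.
by move=> a; apply: loop_eq => /=; rewrite -[in RHS](src_loop_ar a) compVg.
Qed.

Fact loop_mulrV : right_inverse (loop_one x) (@loop_inv x) (@loop_mul x).
Proof.
by move=> a; apply: loop_eq => /=; rewrite -[in RHS](tgt_loop_ar a) compgV.
Qed.

HB.instance Definition _ := isGroup.Build (loop x)
  loop_mulA loop_mul1 loop_mulr1 loop_mulV loop_mulrV.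

End LoopGroup.

(** Pastes n copies of the commuting square l h = h k. It serves both conjugation of loops and
    naturality. *)
Lemma loop_expg_square x y (k : loop x) (l : loop y) h :
  src G h = x -> tgt G h = y ->
  (forall e e', comp G (loop_ar l) h e = comp G h (loop_ar k) e') ->
  forall n e e', comp G (loop_ar (l ^+ n)) h e = comp G h (loop_ar (k ^+ n)) e'.
Proof.
move=> sh th E; elim=> [|n IH] e e'; first by rewrite comp_idl comp_idr.
have eh (m : loop y) : tgt G h = src G (loop_ar m) by rewrite src_loop_ar.
have he (m : loop x) : tgt G (loop_ar m) = src G h by rewrite tgt_loop_ar.
have El : loop_ar (l ^+ n.+1) =
    comp G (loop_ar l) (loop_ar (l ^+ n)) (loop_composable _ _).
  by rewrite expgS.
have Ek : loop_ar (k ^+ n.+1) =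
    comp G (loop_ar k) (loop_ar (k ^+ n)) (loop_composable _ _).
  by rewrite expgS.
have e1 : tgt G h =
    src G (comp G (loop_ar l) (loop_ar (l ^+ n)) (loop_composable _ _)).
  by rewrite -El.
have e2 : tgt G (comp G (loop_ar (l ^+ n)) h (eh _)) = src G (loop_ar l).
  by rewrite tgt_comp tgt_loop_ar src_loop_ar.
have e3 : tgt G (comp G h (loop_ar (k ^+ n)) (he _)) = src G (loop_ar l).
  by rewrite tgt_comp.
have e4 : tgt G (loop_ar (k ^+ n)) = src G (comp G (loop_ar l) h (eh _)).
  by rewrite src_comp.
have e5 : tgt G (loop_ar (k ^+ n)) = src G (comp G h (loop_ar k) (he _)).
  by rewrite src_comp tgt_loop_ar src_loop_ar.
have e6 : tgt G (comp G (loop_ar k) (loop_ar (k ^+ n)) (loop_composable _ _))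
    = src G h.
  by rewrite -Ek.
transitivity (comp G _ _ e1); first exact: comp_eq.
rewrite -(compA e2).
transitivity (comp G _ _ e3); first by apply: comp_eq.
rewrite (compA _ e4).
transitivity (comp G _ _ e5); first by apply: comp_eq.
rewrite -(compA e6).
exact: comp_eq.
Qed.

End Loops.

Lemma loop_expg_conj (G : topGroupoid) (g : tar G) n :
  (forall l : loop G (tgt G g), l ^+ n = 1) ->
  forall k : loop G (src G g), k ^+ n = 1.
Proof.
move=> H k.
(* The target of this inertia arrow is the loop l = g k g^-1; then g k^n = l^n g = g, and g
   cancels. *)
pose a := @InertiaAr G (InertiaOb (src_loop_ar k) (tgt_loop_ar k)) g erefl.
pose l := Loop (src_conj_loop a) (tgt_conj_loop a).
have e : tgt G g = src G (loop_ar (l ^+ n)) by rewrite src_loop_ar.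
have e' : tgt G (loop_ar (k ^+ n)) = src G g by rewrite tgt_loop_ar.
have E : comp G (loop_ar (l ^+ n)) g e = comp G g (loop_ar (k ^+ n)) e'.
  apply: loop_expg_square => // e1 e2.
  by rewrite /= (conj_loopE (a := a) e1); exact: comp_eq.
have {e} E : comp G g (loop_ar (k ^+ n)) e' = g.
  by rewrite -E; move: e {E}; rewrite H => e; exact: comp_idl.
have e1 : tgt G (comp G g (loop_ar (k ^+ n)) e') = src G (inv G g).
  by rewrite tgt_comp src_inv.
apply: loop_eq; rewrite -(compKl e1).
have e2 : tgt G g = src G (inv G g) by rewrite src_inv.
transitivity (comp G (inv G g) g e2); last exact: compVg.
exact: comp_eq.
Qed.

(** * A uniform exponent for all loops *)

Lemma loop_exponent_near (G : topGroupoid) (x : tob G) :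
  locally_compact [set: tob G] -> etale (src G) ->
  proper_map (fun g : tar G => (src G g, tgt G g)) ->
  exists N : nat, \forall y \near x, forall l : loop G y, l ^+ N`! = 1.
Proof.
move=> lcG es pG; have /= := lcG x I; rewrite withinET => -[K nK [cK _]].
have cD : compact ((fun y : tob G => (y, y)) @` K).
  apply: continuous_compact => //; apply: continuous_subspaceT => y.
  by apply: cvg_pair; exact: cvg_id.
have [N HN] := etale_fibre_bound es (pG _ cD).
exists N; apply: filterS nK => y Ky l.
(* All powers of l lie in the fibre of s over y, so l^i = l^j with 0 < j - i <= N, and j - i divides
   N!. *)
have [||i [j [/andP[lt le]]]] := HN y (fun k => loop_ar (l ^+ k)).
- by move=> k; exists y => //; rewrite src_loop_ar tgt_loop_ar.
- by move=> k; rewrite src_loop_ar.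
move=> E; have {}E : l ^+ i = l ^+ j by exact: loop_eq.
have lij : l ^+ (j - i) = 1 by rewrite expgnFr ?(ltnW lt)// -E mulgV.
have /dvdnP [q ->] : (j - i %| N`!)%N.
  by rewrite dvdn_fact// subn_gt0 lt (leq_trans (leq_subr _ _) le).
by rewrite mulnC expgnA lij expg1n.
Qed.

Lemma loop_exponent (G : topGroupoid) : orbigroupoid G -> orbit_compact G ->
  exists N : nat, forall (x : tob G) (l : loop G x), l ^+ N`! = 1.
Proof.
move=> [[_ lcG _ _] _ es _ pG] /compact_near_coveringP cG.
pose P N (q : orbit_space G) := forall y : tob G,
  \pi_(orbit_space G)%qT y = q -> forall l : loop G y, l ^+ N`! = 1.
(* As N! divides M! for N <= M, local bounds persist for all larger M; compactness along [\oo] then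
   yields a common one. *)
have [|N HN] := filter_ex (cG nat \oo P _ _); last first.
  by exists N => x l; exact: HN.
elim/quotW => x _.
have [N HN] := loop_exponent_near x lcG es pG.
pose V := (fun y : tob G => forall l : loop G y, l ^+ N`! = 1)°.
pose W : set (orbit_space G) := [set \pi_(orbit_space G)%qT y | y in V].
have oW : open W.
  rewrite /open/= /quotient_open.
  (* The preimage of W is the saturation of V, open because s is an open map. *)
  rewrite (_ : _ @^-1` _ = src G @` (tgt G @^-1` V)); last first.
    apply/seteqP; split => [y [v Vv /eqmodP /asboolP [g [sg tg]]]|].
      exists (inv G g); rewrite ?src_inv// /preimage/= tgt_inv sg//.
    move=> _ [g Vg <-]; exists (tgt G g) => //; apply/eqmodP/asboolP.
    by exists (inv G g); rewrite src_inv tgt_inv.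
  apply: etale_open_map => //; apply: open_comp; last exact: open_interior.
  by move=> g _; exact: tgt_continuous.
exists (W, [set M | (N <= M)%N]) => /=.
  split; last exact: nbhs_infty_ge.
  by apply: (@open_nbhs_nbhs (orbit_space G)); split => //; exists x.
move=> [_ M] [/= [v Vv <-] NM] y /eqmodP /asboolP [g [sg tg]]; subst.
move=> l; rewrite (fact_split NM) expgnA.
have -> : l ^+ N`! = 1 by apply: loop_expg_conj; exact: interior_subset Vv.
exact: expg1n.
Qed.

(** * Functors from Z/n as loops *)

Lemma expgn_mod (T : groupType) (x : T) p k :
  x ^+ p = 1 -> x ^+ (k %% p) = x ^+ k.
Proof.
by move=> xp; rewrite [in RHS](divn_eq k p) expgnDr mulnC expgnA xp expg1n mul1g.
Qed.

Section LoopFunctor.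
Variables (G : topGroupoid) (m : nat).
Hypothesis Gm : forall (x : tob G) (l : loop G x), l ^+ m.+1 = 1.
Local Notation Z := (one_object (Zmod m.+1)).

Lemma cfunctor_eq (f f' : cfunctor Z G) :
  fob f tt = fob f' tt -> (forall i, far f i = far f' i) -> f = f'.
Proof.
case: f f' => [[a b c d e g] h i] [[a' b' c' d' e' g'] h' i'] /= E1 E2.
have {E2}E2 : b = b' by exact/funext.
have {E1}E1 : a = a' by apply/funext => -[].
subst; have -> : c = c' by exact: Prop_irrelevance.
have -> : d = d' by exact: Prop_irrelevance.
have -> : e = e' by exact: Prop_irrelevance.
have -> : g = g' by exact: Prop_irrelevance.
by congr CFunctor; exact: Prop_irrelevance.
Qed.

Definition inertia_loop (p : inertia_ob G) : loop G (in_pt p) :=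
  Loop (src_loop p) (tgt_loop p).

Program Definition loop_functor (p : inertia_ob G) : functor Z G :=
  @Functor _ _ _ _ Z G (fun=> in_pt p)
    (fun i : 'I_m.+1 => loop_ar (inertia_loop p ^+ i)) _ _ _ _.
Next Obligation. by move=> p i /=; rewrite src_loop_ar. Qed.
Next Obligation. by move=> p i /=; rewrite tgt_loop_ar. Qed.
Next Obligation. by []. Qed.
Next Obligation.
move=> p i j /= _ e'.
rewrite -[RHS]/(comp G _ _ _).
(* Addition in ['I_m.+1] is modulo m + 1; functoriality rests on the exponent hypothesis [Gm]. *)
rewrite (expgn_mod (i + j) (Gm (inertia_loop p))) expgnDr.
exact: comp_eq.
Qed.

Definition loop_cfunctor (p : inertia_ob G) : cfunctor Z G :=
  @CFunctor Z G (loop_functor p)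
    (@discrete_continuous (discrete_topology unit) _ _)
    (@discrete_continuous (discrete_topology (Zmod m.+1)) _ _).

Program Definition inertia_gmap_ar (a : inertia_ar G) : gmap_ar Z G :=
  @GMapAr Z G (loop_cfunctor (in_src a)) (loop_cfunctor (in_tgt a))
    (@CNat Z G _ _ (fun=> in_ar a) _ _ _ _).
Next Obligation.
by move=> a; exact: (@discrete_continuous (discrete_topology unit)).
Qed.
Next Obligation. by move=> a x /=; rewrite src_in_ar. Qed.
Next Obligation. by []. Qed.
Next Obligation.
move=> a i /= e e'; apply: loop_expg_square => [||e1 e2] //.
  exact: src_in_ar.
by rewrite /= (conj_loopE (a := a) e1); exact: comp_eq.
Qed.

Program Definition inertia_to_gmap : functor (inertia G) (GMap Z G) :=
  @Functor _ _ _ _ (inertia G) (GMap Z G) loop_cfunctor inertia_gmap_ar _ _ _ _.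
Next Obligation. by []. Qed.
Next Obligation. by []. Qed.
Next Obligation.
move=> p; apply: gmap_ar_eq => //=; congr loop_cfunctor.
exact: (tgt_id (inertia_str G)).
Qed.
Next Obligation.
move=> b a e e'; apply: gmap_ar_eq => [||x] //=.
- by congr loop_cfunctor; exact: (tgt_comp (g0 := inertia_str G)).
- exact: comp_eq.
Qed.

(* [Zp1] generates 'I_m.+1 also when m = 0, where it is the unit. *)
Definition cfunctor_loop (f : cfunctor Z G) : loop G (fob f tt) :=
  @Loop _ _ G (fob f tt) (far f (@Zp1 m)) (src_far f _) (tgt_far f _).

(** A functor is determined by the image of the generator, since every element is a multiple of
    it. *)
Lemma cfunctor_loopX (f : cfunctor Z G) (k : nat) :
  loop_ar (cfunctor_loop f ^+ k) = far f (inZp k : 'I_m.+1).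
Proof.
elim: k => [|k IH].
  rewrite -[LHS]/(idar G (fob f tt)) -(far_id f tt).
  by congr (far f); apply: val_inj; rewrite /= mod0n.
have e : tgt Z (inZp k : 'I_m.+1) = src Z (@Zp1 m) by [].
have e' : tgt G (far f (inZp k : 'I_m.+1)) = src G (far f (@Zp1 m)).
  by rewrite tgt_far src_far.
transitivity (far f (comp Z _ _ e)).
  rewrite (far_comp e e') expgS; exact: comp_eq.
by congr (far f); apply: val_inj; rewrite /= modnDm.
Qed.

Definition gmap_inertia_ob (f : cfunctor Z G) : inertia_ob G :=
  InertiaOb (src_loop_ar (cfunctor_loop f)) (tgt_loop_ar (cfunctor_loop f)).

Definition gmap_inertia_ar (b : gmap_ar Z G) : inertia_ar G :=
  @InertiaAr G (gmap_inertia_ob (gm_src b)) (b tt) (src_nat b tt).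

(** Naturality at the generator is the equation that characterizes the conjugate loop. *)
Lemma gmap_inertia_ar_tgt b :
  in_tgt (gmap_inertia_ar b) = gmap_inertia_ob (gm_tgt b).
Proof.
apply: inertia_ob_eq; apply/esym.
have e : tgt G (b tt) = src G (far (gm_tgt b) (@Zp1 m)).
  by rewrite tgt_nat src_far.
have e' : tgt G (far (gm_src b) (@Zp1 m)) = src G (b tt).
  by rewrite src_nat tgt_far.
apply: (conj_loop_uniq (a := gmap_inertia_ar b) (e := e)).
transitivity (comp G _ _ e'); last exact: comp_eq.
exact: (natural (g := (@Zp1 m : tar Z)) e e').
Qed.

Program Definition gmap_to_inertia : functor (GMap Z G) (inertia G) :=
  @Functor _ _ _ _ (GMap Z G) (inertia G) gmap_inertia_ob gmap_inertia_ar
    _ _ _ _.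
Next Obligation. by []. Qed.
Next Obligation. by move=> b; exact: gmap_inertia_ar_tgt. Qed.
Next Obligation. by move=> f; exact: inertia_ar_eq. Qed.
Next Obligation.
by move=> b a e e'; apply: inertia_ar_eq => //=; exact: comp_eq.
Qed.

Lemma loop_cfunctorK : cancel loop_cfunctor gmap_inertia_ob.
Proof.
move=> p; apply: inertia_ob_eq => /=.
(* The generator has value 1 modulo m + 1, which is 0 when m = 0; [Gm] then forces the loop to be
   trivial. *)
by rewrite (expgn_mod 1 (Gm (inertia_loop p))) expg1.
Qed.

Lemma gmap_inertia_obK : cancel gmap_inertia_ob loop_cfunctor.
Proof.
move=> f; apply: cfunctor_eq => // i /=.
rewrite -[LHS]/(loop_ar (cfunctor_loop f ^+ (i : 'I_m.+1))) cfunctor_loopX.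
by rewrite valZpK.
Qed.

Lemma inertia_gmap_iso : groupoid_iso (inertia G) (GMap Z G).
Proof.
exists inertia_to_gmap, gmap_to_inertia; split => /=.
- exact: loop_cfunctorK.
- exact: gmap_inertia_obK.
- by move=> a; apply: inertia_ar_eq => //=; exact: loop_cfunctorK.
- move=> b; apply: gmap_ar_eq => [||[]] //=.
  + exact: gmap_inertia_obK.
  + by rewrite gmap_inertia_ar_tgt gmap_inertia_obK.
Qed.

End LoopFunctor.

Theorem proposition6p6 (G : topGroupoid) (hG : orbigroupoid G)
  (hc : orbit_compact G) :
  exists n : nat, (1 <= n)%N /\
    groupoid_iso (inertia G) (GMap (one_object (Zmod n)) G).
Proof.
have [N HN] := loop_exponent hG hc.
(* This is N!, written as a successor to match [m.+1]. *)
exists (N`!).-1.+1; split=> //; apply: inertia_gmap_iso => x l.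
by rewrite prednK ?fact_gt0.
Qed.
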